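(* Let $n \geq 2$ and let $G$ be the complete directed graph on a vertex set $V$ with $|V| = n$ (edge set $E = \{(u,v) : u,v \in V, u \neq v\}$, so $|E| = n(n-1)$, no loops or multiple edges), and let $s \in V$. Then every valid relaxation sequence for $G$ (with source $s$) has length at least $(\frac{1}{2} - o(1))n^3$, where $o(1)$ denotes a quantity tending to $0$ as $n \to \infty$.
   Context: A relaxation sequence for $G$ is a finite sequence $S = (e_1, \dots, e_L)$ of edges $e_i \in E$; its length is $L$. A sequence $S$ of edges contains a simple directed path $(v_1, \dots, v_k)$ if the edges $(v_1,v_2), (v_2,v_3), \dots, (v_{k-1},v_k)$ occur in $S$ as a subsequence in this order (not necessarily contiguously). A relaxation sequence $S$ is valid (with source $s$) if it contains every simple directed path $(s, u_1, \dots, u_{n-1})$ where $\{u_1,\dots,u_{n-1}\} = V \setminus \{s\}$; equivalently, it contains every simple directed path in $G$ starting at $s$. (This is exactly the condition under which performing the Bellman–Ford relaxations $d(s,v) \leftarrow \min\{d(s,v), d(s,u)+w(u,v)\}$ in the order of $S$, starting from $d(s,s)=0$ and $d(s,v)=+\infty$ otherwise, yields correct shortest-path distances from $s$ for every real edge-weight function $w$ without negative cycles.) *)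

(* Defs.v *)
From mathcomp Require Import all_boot.

Set Implicit Arguments.
Unset Strict Implicit.
Unset Printing Implicit Defensive.

Definition complete_digraph (V : finType) : rel V := [rel u v | u != v].
Arguments complete_digraph : clear implicits.

(* A directed graph is given by its adjacency relation [e]; an edge is an
   ordered pair of vertices related by [e]. *)
Definition relaxation_sequence (V : finType) (e : rel V) (S : seq (V * V)) : bool :=
  all [pred uv | e uv.1 uv.2] S.

(* [(v_1, v_2); (v_2, v_3); ...; (v_{k-1}, v_k)] for [p = [v_1; ...; v_k]]. *)
Definition path_edges (V : Type) (p : seq V) : seq (V * V) := zip p (behead p).

(* [subseq] does not require contiguity. *)
Definition contains_path (V : finType) (S : seq (V * V)) (p : seq V) : bool :=
  subseq (path_edges p) S.

Definition simple_dipath (V : finType) (e : rel V) (v : V) (p : seq V) : bool :=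
  path e v p && uniq (v :: p).

(* By simplicity of [s :: us], [us =i predC1 s] makes [us] an enumeration
   without repetition of all the vertices other than [s]. *)
Definition valid_relaxation_sequence (V : finType) (e : rel V) (s : V)
    (S : seq (V * V)) : Prop :=
  relaxation_sequence e S /\
  forall us : seq V, simple_dipath e s us -> us =i predC1 s ->
    contains_path S (s :: us).

(* Main.v *)
(* For a matching A of k edges avoiding s, any order of the edges of A can be
   completed to a Hamiltonian path from s, so the subsequence of S formed by the
   edges of A contains all enumerations of A.  Such a sequence has length at
   least (1 - o(1)) k^2 (Kleitman and Kwiatkowski).  The edges avoiding s split
   into 2n matchings of about n/2 edges each, whence 2n (n/2)^2 = n^3/2.

   For the bound (1 - o(1)) k^2, cut a shorter sequence into boundedly many
   windows and group the symbols into equal classes of symbols having almost the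
   same number of occurrences in each window.  Always asking for the symbol of a
   class of u remaining symbols that comes last consumes about u occurrences of
   the class per pick.  Cut each window into pieces and give a class with r
   occurrences per symbol a share of the pieces proportional to 1/r: then all
   classes are used at the same rate, and by the inequality between arithmetic
   and harmonic means that rate is at most (window length)/k^2.  Whatever symbols
   are picked, the rest of a class keeps the same density in later windows, so
   the sequence is exhausted before any class is. *)
Require Import Defs.
From mathcomp Require Import all_boot all_order all_algebra ring lra zify.
Import Order.TTheory GRing.Theory Num.Theory.

Set Implicit Arguments.
Unset Strict Implicit.
Unset Printing Implicit Defensive.

(** * Sequences containing all enumerations of a set *)

(* Leftmost embedding of [l] needs at least all of [I]. *)
Definition exhausts (T : eqType) (l I : seq T) : Prop :=
  forall l' I', subseq (l ++ l') (I ++ I') -> subseq l' I'.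

Lemma exhausts_cat (T : eqType) (l1 l2 I1 I2 : seq T) :
  exhausts l1 I1 -> exhausts l2 I2 -> exhausts (l1 ++ l2) (I1 ++ I2).
Proof. by move=> e1 e2 l' I'; rewrite -!catA => /e1/e2. Qed.

(** The leftmost embedding of [l] into [I ++ I'] has to leave [I], so what follows [l] is matched
    inside [I']. *)
Lemma not_subseq_exhausts (T : eqType) (l I : seq T) :
  ~~ subseq l I -> exhausts l I.
Proof.
elim: I l => [|x I IH] [|y l] //= H l' I' /=.
  exact/(subseq_trans (suffix_subseq (y :: l) l')).
case: ifP H => _ /IH; first by apply.
by rewrite -cat_cons => h; apply: h.
Qed.

(** Each pick is the remaining symbol of [U] whose first occurrence in [I] is latest. The prefix up
    to it contains all remaining symbols, of which there are more than [k], so [q] picks would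
    consume [q * k] occurrences. *)
Lemma greedy_exhaust (T : finType) (U : {set T}) (k q : nat) (I : seq T) :
  k + q <= #|U| -> count (mem U) I < q * k ->
  exists l, [/\ uniq l, {subset l <= U}, size l <= q & ~~ subseq l I].
Proof.
elim: q U I => [|q IH] U I hU hc; first by move: hc; rewrite mul0n.
have [x0 x0U] : exists x0, x0 \in U by apply/card_gt0P; lia.
have [x xU xmax] := @arg_maxnP T x0 (mem U) (index^~ I) x0U.
have {}xU : x \in U := xU.
have [xI|xI] := boolP (x \in I); last first.
  exists [:: x]; split=> //=; first by move=> z; rewrite inE => /eqP ->.
  by rewrite sub1seq.
pose i := index x I.
have iI : i < size I by rewrite index_mem.
have eI : I = take i I ++ x :: drop i.+1 I.
  by rewrite -{1}(cat_take_drop i I) (drop_nth x) // nth_index.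
have xt : x \notin take i I by rewrite in_take // ltnn.
have cU : #|U| <= count (mem U) (take i.+1 I).
  rewrite -size_filter; apply: leq_trans (card_size _).
  apply/subset_leq_card/subsetP => y yU.
  have yi : index y I <= i := xmax y yU.
  have yI : y \in I by rewrite -index_mem (leq_ltn_trans yi).
  by rewrite mem_filter /= yU in_take.
have := hc; rewrite -{1}(cat_take_drop i.+1 I) count_cat => hc'.
have [||l [ul lU sl nl]] := IH (U :\ x) (drop i.+1 I).
- by move: hU; rewrite (cardsD1 x U) xU /=; lia.
- have h : count (mem (U :\ x)) (drop i.+1 I) <= count (mem U) (drop i.+1 I).
    by apply: sub_count => y; apply: (subsetP (subD1set U x)).
  by move: hc'; rewrite mulSn; lia.
exists (x :: l); split=> //=.
- by rewrite ul andbT; apply/negP => /lU; rewrite !inE eqxx.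
- move=> z; rewrite inE => /orP[/eqP->//|/lU]; by rewrite inE => /andP[].
- rewrite eI; apply: contra nl; elim: (take i I) xt => [|z w IHw] /=; first by rewrite eqxx.
  by rewrite inE negb_or => /andP[/negbTE ->]; exact: IHw.
Qed.

(** A piece is exhausted by symbols of its assigned class alone. Removing picked symbols only lowers
    the counts in later pieces, and the quotas [q] are budgeted so that enough of each class
    survives. *)
Lemma exhaust_pieces (T C : finType) (D : C -> {set T}) (k : C -> nat)
    (q : seq T * C -> nat) (zs : seq (seq T * C)) :
  (forall c c', c != c' -> [disjoint D c & D c']) ->
  (forall z, z \in zs -> count (mem (D z.2)) z.1 < q z * k z.2) ->
  (forall c, k c + \sum_(z <- zs | z.2 == c) q z <= #|D c|) ->
  exists l, [/\ uniq l, forall x, x \in l -> exists c, x \in D c,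
    exhausts l (flatten (unzip1 zs)) & forall c, k c <= #|D c :\: [set x in l]|].
Proof.
elim: zs D => [|[I d] zs IH] D dis hcount hk.
  exists [::]; split=> // c; have := hk c; rewrite big_nil addn0.
  by have -> : D c :\: [set x in [::]] = D c by apply/setP => x; rewrite !inE.
have [||l1 [ul1 l1D sl1 nl1]] := @greedy_exhaust T (D d) (k d) (q (I, d)) I.
- by have := hk d; rewrite big_cons eqxx /=; lia.
- by apply: (hcount (I, d)); rewrite inE eqxx.
pose D' c := D c :\: [set x in l1].
have D'D c : D' c \subset D c by apply: subsetDl.
have D'ne c : c != d -> D' c = D c.
  move=> cd; apply/setP => x; rewrite !inE andbC; apply: andb_idr => xc.
  by apply/negP => /l1D xd; have /disjoint_setI0/setP/(_ x) := dis _ _ cd; rewrite !inE xc xd.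
have [|||l [ul lD el kl]] := IH D'.
- by move=> c c' /dis; apply: disjointW.
- move=> z zz; apply: leq_ltn_trans (hcount z _); last by rewrite inE zz orbT.
  by apply: sub_count => x; apply: (subsetP (D'D _)).
- move=> c; have := hk c; rewrite big_cons /=; have [<-|cd] := eqVneq d c; last first.
    by rewrite D'ne // eq_sym.
  have : #|[set x in l1]| <= q (I, d) by rewrite cardsE (leq_trans (card_size _)).
  have := subset_leq_card (subsetIr (D d) [set x in l1]).
  by rewrite /D'; have := cardsID [set x in l1] (D d); lia.
exists (l1 ++ l); split.
- rewrite cat_uniq ul1 ul andbT /=; apply/hasPn => x /lD[c].
  by rewrite !inE => /andP[].
- by move=> x; rewrite mem_cat => /orP[/l1D|/lD[c /(subsetP (D'D _))]]; [exists d|exists c].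
- by apply: exhausts_cat => //; apply: not_subseq_exhausts.
- move=> c; apply: leq_trans (kl c) _; apply: subset_leq_card.
  by apply/subsetP => x; rewrite !inE mem_cat negb_or -andbA => /and3P[-> -> ->].
Qed.

(** * Balanced distribution of pieces over classes *)

Section Balance.
Local Open Scope ring_scope.

(* Derandomised second-moment method: assigning the next [x] to [c] with
   probability [p c] increases the expected sum of squared deviations only by
   the variance, so some choice of [c] does no worse. *)
Lemma balanced_assignment (R : realFieldType) (T : eqType) (C : finType)
    (p : C -> R) (o : T -> C -> R) (L : R) (xs : seq T) :
  (forall c, 0 <= p c) -> \sum_c p c = 1 ->
  (forall x c, x \in xs -> 0 <= o x c <= L) ->
  exists2 cs : seq C, size cs = size xs &
    \sum_c (\sum_(z <- zip xs cs) ((z.2 == c)%:R - p c) * o z.1 c) ^+ 2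
      <= (size xs)%:R * L ^+ 2.
Proof.
move=> p0 p1; elim: xs => [|x xs IH] hL.
  exists [::] => //; rewrite big1 ?mul0r // => c _; by rewrite big_nil expr0n.
have [|cs scs hcs] := IH; first by move=> y c yx; apply: hL; rewrite inE yx orbT.
set X := fun c => \sum_(z <- zip xs cs) ((z.2 == c)%:R - p c) * o z.1 c.
pose G d := \sum_c (((d == c)%:R - p c) * o x c + X c) ^+ 2.
suff [d hd] : exists d, G d <= \sum_c X c ^+ 2 + L ^+ 2.
  exists (d :: cs); first by rewrite /= scs.
  rewrite /= -natr1 mulrDl mul1r; apply: le_trans (lerD hcs (lexx (L ^+ 2))).
  apply: le_trans hd; rewrite le_eqVlt; apply/orP; left; apply/eqP.
  by apply: eq_bigr => c _; rewrite big_cons.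
have avg : \sum_d p d * G d <= \sum_c X c ^+ 2 + L ^+ 2.
  (* The deviation of the new choice has mean 0, so the cross term vanishes and only the variance is
     added. *)
  have E c : \sum_d p d * (((d == c)%:R - p c) * o x c + X c) ^+ 2
      = X c ^+ 2 + p c * (1 - p c) * o x c ^+ 2.
    have sd : \sum_d p d * (d == c)%:R = p c.
      rewrite (bigD1 c) //= eqxx mulr1 big1 ?addr0 // => d /negbTE ->; exact: mulr0.
    have -> : \sum_d p d * (((d == c)%:R - p c) * o x c + X c) ^+ 2 =
      \sum_d (p d * (X c - p c * o x c) ^+ 2 +
        p d * (d == c)%:R * (o x c ^+ 2 + 2 * o x c * (X c - p c * o x c))).
      by apply: eq_bigr => d _; case: eqP => _ /=; ring.
    rewrite big_split /= -!mulr_suml p1 sd; ring.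
  rewrite (eq_bigr (fun d => \sum_c p d * (((d == c)%:R - p c) * o x c + X c) ^+ 2)); last first.
    by move=> d _; rewrite mulr_sumr.
  rewrite exchange_big /= (eq_bigr _ (fun c _ => E c)) big_split /= lerD2l.
  rewrite -[leRHS]mul1r -p1 mulr_suml; apply: ler_sum => c _.
  have /andP[o0 oL] := hL x c (mem_head _ _).
  have o2 : o x c ^+ 2 <= L ^+ 2 by rewrite ler_sqr // nnegrE; lra.
  have := p0 c; have := sqr_ge0 (p c); have := sqr_ge0 (o x c); nra.
have [/existsP[d hd]|/existsPn hn] := boolP [exists d, G d <= \sum_c X c ^+ 2 + L ^+ 2].
  by exists d.
exfalso; move: avg; apply/negP; rewrite -ltNge.
rewrite -[ltLHS]mul1r -p1 mulr_suml.
have [c pc] : exists c, 0 < p c.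
  have [/existsP[c hc]|/existsPn hn'] := boolP [exists c, 0 < p c]; first by exists c.
  move: p1; rewrite big1 => [/eqP|c _]; first by rewrite eq_sym oner_eq0.
  by apply/eqP; move: (hn' c) (p0 c); rewrite lt_def negb_and negbK => /orP[//|/negP].
rewrite (bigD1 c) //= [ltRHS](bigD1 c) //=; apply: ltr_leD.
  by rewrite ltr_pM2l // ltNge hn.
by apply: ler_sum => d _; apply: ler_wpM2l => //; rewrite ltW // ltNge hn.
Qed.
End Balance.

Lemma sum_count_mem (T : finType) (A : {set T}) (s : seq T) :
  \sum_(x in A) count_mem x s = count (mem A) s.
Proof.
elim: s => [|y s IH] /=; first by rewrite big1.
rewrite big_split /= IH; congr (_ + _); case: (boolP (y \in A)) => yA.
  by rewrite (bigD1 y) //= eqxx big1 // => x /andP[_ /negbTE]; rewrite eq_sym => ->.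
by rewrite big1 // => x xA; case: eqP yA xA => // -> /negbTE ->.
Qed.

(** * Exhausting one window, then all windows *)

Section Window.
Local Open Scope ring_scope.

Lemma AM_HM_sum (R : realFieldType) (C : finType) (r : C -> R) :
  (0 < #|C|)%N -> (forall c, 0 < r c) ->
  (\sum_c (r c)^-1)^-1 <= (\sum_c r c) / #|C|%:R ^+ 2.
Proof.
move=> C0 r0; set Z := \sum_c (r c)^-1.
have Z0 : 0 < Z.
  have [c _] : exists c : C, c \in C by apply/card_gt0P.
  rewrite /Z (bigD1 c) //=; apply: ltr_wpDr; last by rewrite invr_gt0.
  by apply: sumr_ge0 => d _; rewrite invr_ge0 ltW.
(* [x] is the harmonic mean of [r]; the claim is the expansion of a sum of terms
   [(r c - x) ^ 2 / r c]. *)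
pose x := #|C|%:R / Z.
have : 0 <= \sum_c (r c - 2 * x + x ^+ 2 * (r c)^-1).
  apply: sumr_ge0 => c _.
  have -> : r c - 2 * x + x ^+ 2 * (r c)^-1 = (r c - x) ^+ 2 / r c.
    by field; rewrite gt_eqF.
  by rewrite divr_ge0 ?sqr_ge0 // ltW.
rewrite big_split big_split /= -mulr_sumr -/Z sumrN sumr_const.
rewrite -[2 * x *+ _]mulr_natr (@eq_card _ _ C) //.
have -> : \sum_c r c - 2 * x * #|C|%:R + x ^+ 2 * Z = \sum_c r c - #|C|%:R ^+ 2 / Z.
  by rewrite /x; field; rewrite gt_eqF.
have C0' : 0 < #|C|%:R ^+ 2 :> R by rewrite exprn_gt0 // ltr0n.
by rewrite ler_pdivlMr // mulrC subr_ge0.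
Qed.

(* The pieces of the window are distributed over the classes with weights
   proportional to [1 / r c], which equalises the number of picks per class. *)
Lemma window_exhaust (R : realFieldType) (T C : finType) (D : C -> {set T})
    (Is : seq (seq T)) (r : C -> R) (L a Q : nat) :
  (forall c c', c != c' -> [disjoint D c & D c']) ->
  (forall c, 0 < r c) ->
  (forall c x, x \in D c -> (count_mem x (flatten Is))%:R <= r c) ->
  (forall I, I \in Is -> (size I <= L)%N) -> (size Is = a ^ 2)%N -> (0 < #|C|)%N ->
  (forall c, (Q < #|D c|)%N) ->
  (forall c, (\sum_c r c) / #|C|%:R ^+ 2 * #|D c|%:R + L%:R * a%:R
     <= (Q%:R - a%:R ^+ 2) * (#|D c|%:R - Q%:R)) ->
  exists l, [/\ uniq l, forall x, x \in l -> exists c, x \in D c,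
    exhausts l (flatten Is) & forall c, (#|D c| <= #|D c :\: [set x in l]| + Q)%N].
Proof.
move=> dis r0 hr hL sIs C0 hQ hnum.
pose Z := \sum_c (r c)^-1.
have Z0 : 0 < Z.
  have [c _] : exists c : C, c \in C by apply/card_gt0P.
  rewrite /Z (bigD1 c) //=; apply: ltr_wpDr; last by rewrite invr_gt0.
  by apply: sumr_ge0 => d _; rewrite invr_ge0 ltW.
pose p c := (r c)^-1 / Z.
have p0 c : 0 <= p c by rewrite /p divr_ge0 ?invr_ge0 // ltW.
have p1 : \sum_c p c = 1 by rewrite /p -mulr_suml divff // gt_eqF.
pose o (I : seq T) c : R := (count (mem (D c)) I)%:R.
have [|cs scs hcs] := @balanced_assignment R _ C p o L%:R Is p0 p1.
  move=> I c /hL sI; rewrite /o ler0n ler_nat; exact: leq_trans (count_size _ _) sI.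
pose zs := zip Is cs.
have uzs : unzip1 zs = Is by rewrite unzip1_zip // scs.
pose k c := (#|D c| - Q)%N.
(* The successor makes the count strictly less than [q z * k z.2]. It costs a class at most one
   extra pick per piece, whence [Q - a ^ 2] in the hypothesis. *)
pose q (z : seq T * C) := (count (mem (D z.2)) z.1 %/ k z.2).+1.
have k0 c : (0 < k c)%N by rewrite subn_gt0.
have tot c : \sum_(z <- zs) o z.1 c <= #|D c|%:R * r c.
  have -> : \sum_(z <- zs) o z.1 c = (count (mem (D c)) (flatten Is))%:R.
    by rewrite -uzs count_flatten sumnE natr_sum !big_map.
  rewrite -sum_count_mem natr_sum -sum1_card natr_sum mulr_suml.
  by apply: ler_sum => x xD; rewrite mul1r hr.
(* In the expected share [p c] cancels [r c], so the rate is the same for all classes; [a ^ 2]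
   pieces of length at most [L] deviate from it by at most [L * a]. *)
have share c : \sum_(z <- zs | z.2 == c) o z.1 c
    <= (\sum_c r c) / #|C|%:R ^+ 2 * #|D c|%:R + L%:R * a%:R.
  set X := \sum_(z <- zs) ((z.2 == c)%:R - p c) * o z.1 c.
  have -> : \sum_(z <- zs | z.2 == c) o z.1 c = p c * \sum_(z <- zs) o z.1 c + X.
    rewrite mulr_sumr -big_split /= big_mkcond; apply: eq_bigr => z _.
    by case: eqP => _ /=; ring.
  apply: lerD.
    apply: le_trans (ler_wpM2l (p0 c) (tot c)) _.
    have -> : p c * (#|D c|%:R * r c) = Z^-1 * #|D c|%:R.
      by rewrite /p; field; rewrite !gt_eqF.
    by rewrite ler_wpM2r // AM_HM_sum.
  have La : 0 <= L%:R * a%:R :> R by rewrite mulr_ge0.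
  have [X0|X0] := lerP X 0; first exact: le_trans X0 La.
  rewrite -ler_sqr ?nnegrE ?(ltW X0) //.
  have -> : (L%:R * a%:R) ^+ 2 = (size Is)%:R * L%:R ^+ 2 :> R.
    by rewrite sIs natrX exprMn mulrC.
  apply: le_trans hcs; rewrite (bigD1 c) //= -/zs -/X lerDl.
  by apply: sumr_ge0 => d _; apply: sqr_ge0.
have qk z : (q z * k z.2 <= count (mem (D z.2)) z.1 + k z.2)%N.
  by rewrite /q mulSn addnC leq_add2r leq_trunc_div.
have nD c : (k c)%:R = #|D c|%:R - Q%:R :> R by rewrite natrB // ltnW.
have sq c : (\sum_(z <- zs | z.2 == c) q z <= Q)%N.
  rewrite -(ler_nat R) -(ler_pM2r (_ : 0 < (k c)%:R :> R)) ?ltr0n //.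
  have szs : (\sum_(z <- zs | z.2 == c) 1 <= a ^ 2)%N.
    by rewrite sum1_count (leq_trans (count_size _ _)) // size_zip scs minnn sIs.
  have : (\sum_(z <- zs | z.2 == c) q z * k c
      <= \sum_(z <- zs | z.2 == c) count (mem (D c)) z.1 + a ^ 2 * k c)%N.
    apply: leq_trans (leq_add (leqnn _) (leq_mul szs (leqnn (k c)))).
    rewrite big_distrl -big_split /=; apply: leq_sum => z /eqP <-.
    by rewrite mul1n.
  rewrite -(ler_nat R) natrD -big_distrl /= !natrM natr_sum => h.
  apply: le_trans h _; have := le_trans (share c) (hnum c); rewrite -nD /o natr_sum; lra.
have [||l [ul lD el kl]] := @exhaust_pieces T C D k q zs dis.
- by move=> z zz; rewrite /q ltn_ceil.
- by move=> c; rewrite /k; have := sq c; have := hQ c; lia.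
rewrite uzs in el; exists l; split=> // c.
by have := kl c; rewrite /k; lia.
Qed.
End Window.

(** The bounds [r] hold symbol by symbol, so they pass to whatever part of a class survives a
    window. The numeric condition ranges over [u] because the intermediate class sizes are not known
    exactly. *)
Lemma windows_exhaust (R : realFieldType) (T C : finType) (D : C -> {set T})
    (Ws : seq (seq (seq T))) (h : R) (L a Q v s : nat) :
  (forall c c', c != c' -> [disjoint D c & D c']) -> 0 < #|C| -> 0 < v ->
  (forall W I, W \in Ws -> I \in W -> size I <= L) ->
  (forall W, W \in Ws -> size W = a ^ 2) ->
  (forall W, W \in Ws -> exists r : C -> R, [/\ (forall c, 0 < r c)%R,
     (forall c x, x \in D c -> (count_mem x (flatten W))%:R <= r c)%R &
     ((\sum_c r c) / #|C|%:R ^+ 2 <= h)%R]) ->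
  (forall c, v + size Ws * Q <= #|D c| <= s) ->
  (forall u, v + Q <= u <= s ->
     (h * u%:R + L%:R * a%:R <= (Q%:R - a%:R ^+ 2) * (u%:R - Q%:R))%R) ->
  exists l, [/\ uniq l, forall x, x \in l -> exists c, x \in D c,
    exhausts l (flatten (map flatten Ws)) & forall c, v <= #|D c :\: [set x in l]|].
Proof.
move=> + C0 v0; elim: Ws D => [|W Ws IH] D dis hL hW hr hD hnum.
  exists [::]; split=> // c; have /andP[+ _] := hD c; rewrite mul0n addn0.
  by have -> : D c :\: [set x in [::]] = D c by apply/setP => x; rewrite !inE.
have [r [r0 rD rh]] := hr W (mem_head _ _).
have [| | | | |l1 [ul1 l1D el1 kl1]] := @window_exhaust R T C D W r L a Q dis r0 rD.
- by move=> I; apply: hL; rewrite mem_head.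
- by rewrite hW ?mem_head.
- exact: C0.
- by move=> c; have := hD c; rewrite /= mulSn; lia.
- move=> c; apply: le_trans (hnum #|D c| _); last by have := hD c; rewrite /= mulSn; lia.
  by rewrite lerD2r ler_wpM2r.
pose D' c := D c :\: [set x in l1].
have D'D c : D' c \subset D c by apply: subsetDl.
have [| | | | |//|l [ul lD el kl]] := IH D'.
- by move=> c c' /dis; apply: disjointW.
- by move=> W' I W'Ws; apply: hL; rewrite inE W'Ws orbT.
- by move=> W' W'Ws; apply: hW; rewrite inE W'Ws orbT.
- move=> W' W'Ws; have [|r' [r'0 r'D r'h]] := hr W'; first by rewrite inE W'Ws orbT.
  by exists r'; split=> // c x /(subsetP (D'D c)); apply: r'D.
- move=> c; have := hD c; have := kl1 c; have := subset_leq_card (D'D c).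
  rewrite /= mulSn /D' => h1 h2 /andP[h3 h4]; rewrite (leq_trans h1 h4) andbT.
  by rewrite -(leq_add2r Q) -addnA [_ * Q + Q]addnC (leq_trans h3 h2).
exists (l1 ++ l); split.
- rewrite cat_uniq ul1 ul andbT /=; apply/hasPn => x /lD[c].
  by rewrite !inE => /andP[].
- by move=> x; rewrite mem_cat => /orP[/l1D//|/lD[c /(subsetP (D'D _))]]; exists c.
- exact: exhausts_cat.
- move=> c; apply: leq_trans (kl c) _; apply: subset_leq_card.
  by apply/subsetP => x; rewrite !inE mem_cat negb_or -andbA => /and3P[-> -> ->].
Qed.

(** * Windows, pieces, and classes of symbols with equal profiles *)

Lemma split_pieces (T : eqType) (m L : nat) (S : seq T) : size S <= m * L ->
  exists Is, [/\ size Is = m, flatten Is = S & forall I, I \in Is -> size I <= L].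
Proof.
elim: m S => [|m IH] S; first by rewrite mul0n leqn0 => /nilP ->; exists [::].
rewrite mulSn => sS; have [|Is [sIs fIs hIs]] := IH (drop L S).
  by rewrite size_drop; lia.
exists (take L S :: Is); split=> /=; rewrite ?sIs // ?fIs ?cat_take_drop //.
by move=> I; rewrite inE => /orP[/eqP ->|/hIs //]; rewrite size_take_min geq_minl.
Qed.

Lemma split_windows (T : eqType) (J m L : nat) (S : seq T) : size S <= J * m * L ->
  exists Ws : seq (seq (seq T)), [/\ size Ws = J, flatten (map flatten Ws) = S,
    forall W, W \in Ws -> size W = m &
    forall W I, W \in Ws -> I \in W -> size I <= L].
Proof.
elim: J S => [|J IH] S; first by rewrite mul0n leqn0 => /nilP ->; exists [::].
rewrite mulSn mulnDl => sS; have [|Ws [sWs fWs hWs hI]] := IH (drop (m * L) S).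
  by rewrite size_drop; lia.
have [|W [sW fW hW]] := @split_pieces T m L (take (m * L) S).
  by rewrite size_take_min geq_minl.
exists (W :: Ws); split=> /=; rewrite ?sWs // ?fW ?fWs ?cat_take_drop //.
- by move=> W'; rewrite inE => /orP[/eqP ->|/hWs].
- by move=> W' I; rewrite inE => /orP[/eqP -> /hW|/hI]; last exact.
Qed.

(** Pigeonhole: while more than [#|F| * s] elements remain, some fibre of [f] has [s] of them to cut
    off as a chunk. *)
Lemma homogeneous_chunks (T F : finType) (f : T -> F) (s M : nat) (A : {set T}) :
  0 < s -> (M + #|F|) * s <= #|A| ->
  exists D : nat -> {set T}, [/\ forall c, c < M -> #|D c| = s,
    forall c, c < M -> D c \subset A,
    forall c c', c < M -> c' < M -> c != c' -> [disjoint D c & D c'] &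
    forall c x y, c < M -> x \in D c -> y \in D c -> f x = f y].
Proof.
move=> s0; elim: M A => [|M IH] A hA.
  by exists (fun=> set0); split=> // c; rewrite ltn0.
have [y hy] : exists y, s <= #|[set x in A | f x == y]|.
  apply/existsP; apply: contraLR hA => /existsPn hn; rewrite -ltnNge.
  have -> : #|A| = \sum_y #|[set x in A | f x == y]|.
    rewrite -sum1_card (partition_big f xpredT) //=; apply: eq_bigr => y _.
    by rewrite -sum1_card; apply: eq_bigl => x; rewrite !inE.
  apply: leq_ltn_trans (_ : #|F| * s < _); last by rewrite ltn_pmul2r //; lia.
  rewrite -sum_nat_const; apply: leq_sum => y _; apply: ltnW.
  by rewrite ltnNge hn.
have [Y [YA fY sY]] : exists Y : {set T}, [/\ Y \subset A, forall x, x \in Y -> f x = y & #|Y| = s].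
  have : 0 < #|[set Y : {set T} | Y \subset [set x in A | f x == y] & #|Y| == s]|.
    by rewrite cards_draws bin_gt0.
  case/card_gt0P => Y; rewrite inE => /andP[/subsetP YA /eqP sY]; exists Y; split=> //.
    by apply/subsetP => x /YA; rewrite inE => /andP[].
  by move=> x /YA; rewrite inE => /andP[_ /eqP].
have [|D [cD DA dD fD]] := IH (A :\: Y).
  by move: hA; rewrite cardsD (setIidPr YA) sY addSn mulSn; lia.
have DY c : c < M -> [disjoint D c & Y].
  by move=> /DA; rewrite subsetD => /andP[].
exists (fun c => if c < M then D c else Y); split.
- by move=> c _; case: ltnP => // /cD.
- move=> c _; case: ltnP => // /DA /subset_trans; apply; exact: subsetDl.
- move=> c c' cM c'M cc'; case: ltnP => hc; case: ltnP => hc'.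
  + exact: dD.
  + exact: DY.
  + by rewrite disjoint_sym DY.
  + by move: cc'; rewrite neq_ltn; lia.
- by move=> c x z _; case: ltnP => hc; [exact: fD|move=> /fY -> /fY ->].
Qed.

Lemma sum_count_disjoint (T C : finType) (D : C -> {set T}) (s : seq T) :
  (forall c c', c != c' -> [disjoint D c & D c']) ->
  \sum_c count (mem (D c)) s <= size s.
Proof.
move=> dis; elim: s => [|x s IH] /=; first by rewrite big1.
rewrite big_split /= -add1n leq_add // {IH}.
have [/existsP[c xc]|/existsPn xD] := boolP [exists c, x \in D c]; last first.
  by rewrite big1 // => c _; rewrite (negbTE (xD c)).
rewrite (bigD1 c) //= xc big1 // => c' cc'.
by have /disjoint_setI0/setP/(_ x) := dis _ _ cc'; rewrite !inE xc andbT => ->.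
Qed.

(* [J] windows of [a ^ 2] pieces of length at most [L]; occurrence counts are
   rounded up to multiples of [d]; at most [e] symbols occur [b * d] times or
   more and are discarded; [M] classes of [s] symbols, of which each window
   uses up at most [Q], leaving [v] at the end. *)
Lemma missed_enumeration (R : realFieldType) (T : finType) (A : {set T}) (S : seq T)
    (J L a b d e s M Q v : nat) :
  size S <= J * a ^ 2 * L -> 0 < d -> 0 < b -> 0 < s -> 0 < M -> 0 < v ->
  size S < e.+1 * (b * d) -> (M + b ^ J) * s + e <= #|A| ->
  v + J * Q <= s ->
  (forall u, v + Q <= u <= s ->
     (((a ^ 2 * L)%:R + (#|A| * d)%:R) / (s%:R * M%:R ^+ 2) * u%:R + L%:R * a%:R
       <= (Q%:R - a%:R ^+ 2) * (u%:R - Q%:R) :> R)%R) ->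
  exists l, [/\ uniq l, {subset l <= A} & ~~ subseq l S].
Proof.
move=> sS d0 b0 s0 M0 v0 sSe hA hv hnum.
have [Ws [sWs fWs hW hI]] := split_windows sS.
pose frequent := [set x in A | b * d <= count_mem x S].
have ce : #|frequent| <= e.
  rewrite -ltnS -(ltn_pmul2r (_ : 0 < b * d)) ?muln_gt0 ?b0 //.
  apply: leq_ltn_trans sSe; apply: leq_trans (count_size (mem frequent) S).
  rewrite -sum_count_mem -sum_nat_const; apply: leq_sum => x.
  by rewrite inE => /andP[].
case: b b0 sSe hA @frequent ce => // b _ sSe hA frequent ce.
(* A symbol that is not frequent has all these quotients below [b.+1], so [inord] does not alter
   them. *)
pose f x : {ffun 'I_J -> 'I_b.+1} :=
  [ffun j : 'I_J => inord (count_mem x (flatten (nth [::] Ws j)) %/ d)].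
have [|D' [cD DA dD fD]] := @homogeneous_chunks T _ f s M (A :\: frequent) s0.
  rewrite card_ffun !card_ord; have := cardsID frequent A.
  have := subset_leq_card (subsetIr A frequent); lia.
pose D (c : 'I_M) := D' c.
have dis (c c' : 'I_M) : c != c' -> [disjoint D c & D c'] by apply: dD; exact: ltn_ord.
have Ds c : #|D c| = s by apply: cD; exact: ltn_ord.
have rep c : exists x, x \in D c by apply/card_gt0P; rewrite Ds.
have prof (W : seq (seq T)) (c : 'I_M) x y : W \in Ws -> x \in D c -> y \in D c ->
    count_mem x (flatten W) %/ d = count_mem y (flatten W) %/ d.
  move=> WWs xc yc; pose j := index W Ws.
  have jJ : j < J by rewrite -sWs index_mem.
  have small z : z \in D c -> count_mem z (flatten W) %/ d < b.+1.
    move=> /(subsetP (DA c (ltn_ord c))); rewrite !inE => /andP[+ zA].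
    rewrite zA /= -ltnNge => zS; rewrite ltn_divLR //; apply: leq_ltn_trans zS.
    rewrite -fWs [leqRHS]count_flatten sumnE !big_map (big_rem W WWs) /=.
    exact: leq_addr.
  have := fD c x y (ltn_ord c) xc yc => /ffunP/(_ (Ordinal jJ)).
  rewrite !ffunE /= nth_index // => /(congr1 val) /=.
  by rewrite !inordK ?small.
have [| | |l [ul lD el vl]] :=
    @windows_exhaust R T 'I_M D Ws _ L a Q v s dis _ v0 hI hW _ _ hnum.
- by rewrite card_ord.
- move=> W WWs.
  (* The rounded count of a representative is the same for the whole class and exceeds the count of
     each symbol by at most [d]. *)
  pose r c : nat := (count_mem (xchoose (rep c)) (flatten W) %/ d).+1 * d.
  have rP c x : x \in D c -> r c = (count_mem x (flatten W) %/ d).+1 * d.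
    by move=> xc; rewrite /r (prof W c _ x WWs (xchooseP (rep c)) xc).
  exists (fun c => (r c)%:R)%R; split.
  + by move=> c; rewrite ltr0n /r muln_gt0.
  + by move=> c x xc; rewrite ler_nat (rP c x xc) ltnW // ltn_ceil.
  + have s0' : (0 < s%:R :> R)%R by rewrite ltr0n.
    have M0' : (0 < M%:R ^+ 2 :> R)%R by rewrite exprn_gt0 // ltr0n.
    rewrite card_ord [X in (_ <= _ * X)%R]invfM [leRHS]mulrA ler_wpM2r ?invr_ge0 ?(ltW M0') //.
    rewrite ler_pdivlMr // -natr_sum -natrM -natrD ler_nat big_distrl /=.
    have -> : \sum_(c < M) r c * s = \sum_(c < M) \sum_(x in D c) r c.
      by apply: eq_bigr => c _; rewrite sum_nat_const Ds mulnC.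
    apply: leq_trans (_ : \sum_(c < M) \sum_(x in D c) (count_mem x (flatten W) + d) <= _).
      apply: leq_sum => c _; apply: leq_sum => x xc; rewrite (rP c x xc) mulSn addnC.
      by rewrite leq_add2r leq_trunc_div.
    under eq_bigr do rewrite big_split /= sum_count_mem sum_nat_const Ds.
    rewrite big_split /= leq_add //.
      apply: leq_trans (sum_count_disjoint _ dis) _; rewrite size_flatten sumnE big_map.
      rewrite -(hW W WWs) -sum1_size big_distrl /= big_seq [leqRHS]big_seq.
      by apply: leq_sum => I IW; rewrite mul1n (hI W).
    rewrite sum_nat_const card_ord mulnA leq_mul2r orbC.
    by apply/orP; left; apply: leq_trans hA; rewrite mulnDl -addnA leq_addr.
- by move=> c; rewrite sWs Ds hv leqnn.
(* [l] exhausts all of [S], so any surviving symbol appended to it is missed. *)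
have [x] : exists x, x \in D (Ordinal M0) :\: [set x in l].
  by apply/card_gt0P; apply: leq_trans v0 (vl _).
rewrite !inE => /andP[xl xD].
have DAx c z : z \in D c -> z \in A.
  by move=> /(subsetP (DA c (ltn_ord c))); rewrite inE => /andP[].
exists (rcons l x); split.
- by rewrite rcons_uniq xl.
- by move=> z; rewrite mem_rcons inE => /orP[/eqP ->|/lD[c]]; [exact: DAx xD|exact: DAx].
- apply/negP; rewrite -cats1 -(cats0 S) -fWs => /el.
  by rewrite sub1seq.
Qed.

(** * Numerical estimates for the choice of parameters *)

Section Numeric.
Local Open Scope ring_scope.

(** Classes have [J * K * Y] symbols, there are [(J - 3) * B] of them, and counts are rounded by
    [B * K * Y]. With [n] about [J ^ 2 * B * K * Y] and [z] at most [(1 - 2 / K) * n ^ 2] the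
    leading term is [(K - 2) * Y]; [J] is large enough for all corrections to fit in [Y / 2]. *)
Lemma density_bound (R : realFieldType) (K J B a n Y z L : R) :
  2 <= K -> J = 40 * K ^+ 2 -> 1 <= B -> 0 <= n -> a ^+ 2 <= Y -> J <= Y ->
  n <= J ^+ 2 * B * K * (Y + 1) -> K * z + 2 * n ^+ 2 <= K * n ^+ 2 ->
  J * (a ^+ 2 * L) <= z + J * a ^+ 2 ->
  (a ^+ 2 * L + n * (B * K * Y)) / (J * K * Y * ((J - 3) * B) ^+ 2) <= (K - 3 / 2) * Y.
Proof.
move=> K2 JE B1 n0 aY JY nle zle Lle.
have J40 : 40 <= J by rewrite JE; nra.
have Y0 : 0 < Y by lra.
have K0 : 0 < K by lra.
have B0 : 0 < B by lra.
have J0 : 0 < J by lra.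
have den : 0 < J * K * Y * ((J - 3) * B) ^+ 2.
  by rewrite !mulr_gt0 ?exprn_gt0 ?mulr_gt0 //; lra.
rewrite ler_pdivrMr //.
have JK0 : 0 < J * K by apply: mulr_gt0.
rewrite -(ler_pM2l JK0).
have nn : n ^+ 2 <= (J ^+ 2 * B * K) ^+ 2 * (Y ^+ 2 * (1 + 3 / J)).
  apply: le_trans (_ : (J ^+ 2 * B * K * (Y + 1)) ^+ 2 <= _).
    by rewrite ler_sqr ?nnegrE // (le_trans n0).
  rewrite exprMn ler_wpM2l ?sqr_ge0 //.
  have : Y * J <= Y * Y by rewrite ler_wpM2l // ltW.
  have -> : Y ^+ 2 * (1 + 3 / J) = Y ^+ 2 + 3 * (Y * Y) / J by field; rewrite gt_eqF.
  move=> h; have : 3 * (Y * J) / J <= 3 * (Y * Y) / J.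
    by rewrite ler_pM2r ?invr_gt0 // ler_wpM2l.
  have -> : 3 * (Y * J) / J = 3 * Y by field; rewrite gt_eqF.
  rewrite !expr2; lra.
have main : (K - 2) * (J ^+ 2 + 3 * J) + K * (J + 2) <= (K - 3 / 2) * (J - 3) ^+ 2.
  by rewrite JE; nra.
have P1 : J * K * (a ^+ 2 * L) <= (K - 2) * n ^+ 2 + J * K * a ^+ 2.
  have := ler_wpM2l (ltW K0) Lle; lra.
have P2 : n * (B * K * Y) <= J ^+ 2 * B ^+ 2 * K ^+ 2 * (Y ^+ 2 + Y).
  have : n * (B * K * Y) <= J ^+ 2 * B * K * (Y + 1) * (B * K * Y).
    by rewrite ler_wpM2r // !mulr_ge0 // ltW.
  lra.
pose G := J ^+ 2 * B ^+ 2 * K ^+ 2 * Y ^+ 2.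
have G0 : 0 < G by rewrite !mulr_gt0 ?exprn_gt0.
have P3 : (K - 2) * n ^+ 2 <= (K - 2) * (J ^+ 2 + 3 * J) * G.
  apply: le_trans (ler_wpM2l _ nn) _; first lra.
  rewrite le_eqVlt; apply/orP; left; apply/eqP; rewrite /G; field; lra.
have YY : J * Y <= Y ^+ 2 by rewrite expr2 ler_wpM2r // ltW.
have JBK : 1 <= J * B ^+ 2 * K.
  by rewrite -[1]mulr1 ler_pM ?mulr_ge0 //; [lra..| |lra]; rewrite -[1]mulr1 ler_pM //; [lra|nra].
have P4 : J * K * a ^+ 2 <= K * G.
  apply: le_trans (_ : J * K * Y <= _); first by rewrite ler_pM2l.
  have -> : K * G = J * K * Y * (J * B ^+ 2 * K * (K * Y)) by rewrite /G; ring.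
  rewrite ler_pMr ?mulr_gt0 // -[1]mulr1 ler_pM //; nra.
have P5 : J ^+ 2 * B ^+ 2 * K ^+ 2 * (J * K * (Y ^+ 2 + Y)) <= K * (J + 1) * G.
  have -> : K * (J + 1) * G = J ^+ 2 * B ^+ 2 * K ^+ 2 * (K * (J + 1) * Y ^+ 2) by rewrite /G; ring.
  rewrite ler_pM2l ?mulr_gt0 ?exprn_gt0 // -!mulrA mulrCA ler_pM2l //; lra.
have P6 := ler_wpM2r (ltW G0) main.
have P7 := ler_wpM2l (ltW JK0) P2.
have -> : J * K * ((K - 3 / 2) * Y * (J * K * Y * ((J - 3) * B) ^+ 2))
    = (K - 3 / 2) * (J - 3) ^+ 2 * G.
  by rewrite /G; field.
lra.
Qed.

(** With [Q = (K - 1) * Y], the bound on [h] leaves a slack of [Y / 2] for each of the at least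
    [J * Y] remaining symbols. It pays for the extra picks, the deviation [L * a] and the shrinking
    of the class during the window. *)
Lemma window_budget (R : realFieldType) (K J X a n Y h L z u : R) :
  2 <= K -> J = 40 * K ^+ 2 -> 1 <= X -> a = 40 * X ^+ 2 * K ^+ 2 ->
  10 * a ^+ 2 <= Y -> 0 <= n -> n <= X * J * K * (Y + 1) -> z <= n ^+ 2 ->
  J * (a ^+ 2 * L) <= z + J * a ^+ 2 -> h <= (K - 3 / 2) * Y ->
  J * Y + (K - 1) * Y <= u ->
  h * u + L * a <= ((K - 1) * Y - a ^+ 2) * (u - (K - 1) * Y).
Proof.
move=> K2 JE X1 aE aY n0 nle zle Lle hle ule.
have X2 : 1 <= X ^+ 2 by nra.
have K22 : 4 <= K ^+ 2 by nra.
have a160 : 160 <= a by rewrite aE; nra.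
have Y1 : 1 <= Y by nra.
have aleY : a <= Y by nra.
have J0 : 0 < J by lra.
have a0 : 0 < a by lra.
(* [a] is chosen to make [(2 * X * J * K * Y) ^ 2] equal to [a * J ^ 2 * Y ^ 2 / 10]. *)
have La : L * a <= J * Y ^+ 2 / 10 + a.
  rewrite -(ler_pM2l J0) -(ler_pM2l a0).
  have -> : a * (J * (L * a)) = J * (a ^+ 2 * L) by ring.
  apply: le_trans Lle _.
  have : n ^+ 2 <= (X * J * K * (2 * Y)) ^+ 2.
    rewrite ler_sqr ?nnegrE //; last by rewrite !mulr_ge0 //; lra.
    apply: le_trans nle _; rewrite ler_wpM2l ?mulr_ge0 //; lra.
  have -> : (X * J * K * (2 * Y)) ^+ 2 = a * (J * (J * Y ^+ 2 / 10)).
    by rewrite aE; field.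
  lra.
pose v := u - (K - 1) * Y.
have uv : u = v + (K - 1) * Y by rewrite /v; ring.
have vle : J * Y <= v by rewrite /v; lra.
have v0 : 0 <= v by apply: le_trans vle; rewrite mulr_ge0 //; lra.
have -> : u - (K - 1) * Y = v by [].
have YY0 : 0 <= Y * Y by nra.
have h1 : h * u <= (K - 3 / 2) * Y * u.
  by rewrite ler_wpM2r // uv addr_ge0 // mulr_ge0; lra.
have h2 : a ^+ 2 * v <= Y / 10 * v by rewrite ler_wpM2r //; lra.
have h3 : J * Y * Y <= v * Y by rewrite ler_wpM2r //; lra.
have h4 : K ^+ 2 * (Y * Y) = J * Y * Y / 40 by rewrite JE; field.
have h5 : Y * Y <= J * Y * Y / 160.
  by rewrite -mulrA; nra.
have h6 : Y <= Y * Y by nra.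
have h7 : K * (Y * Y) <= K ^+ 2 * (Y * Y) by rewrite ler_wpM2r //; nra.
have h8 : 0 <= K * (Y * Y) by rewrite mulr_ge0 //; lra.
move: h1; rewrite uv; lra.
Qed.
End Numeric.

(** Integer form of [(1 - 2 / K) * #|A| ^ 2 <= size S], with [K] arbitrary and [N] depending on [K]
    alone. *)
Theorem enumerations_lower_bound (K : nat) : 1 < K ->
  exists N, forall (T : finType) (A : {set T}) (S : seq T), N <= #|A| ->
    (forall l, uniq l -> {subset l <= A} -> subseq l S) ->
    K * #|A| ^ 2 <= K * size S + 2 * #|A| ^ 2.
Proof.
(* The existentials keep the large parameters opaque. In a sequence of length at most [n ^ 2],
   [b = 2 * J ^ 3] leaves at most [n %/ J] symbols to discard. *)
move=> K1; have [J JE] : {J | J = 40 * K ^ 2} by eexists.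
have [b bE] : {b | b = 2 * J ^ 3} by eexists.
have [B BE] : {B | B = b ^ J} by eexists.
have [X XE] : {X | X = J * B} by eexists.
have [a aE] : {a | a = 40 * X ^ 2 * K ^ 2} by eexists.
have K0 : 0 < K by apply: ltnW.
have J3 : 3 < J by rewrite JE; nia.
have J0 : 0 < J by apply: ltn_trans J3.
have b0 : 0 < b by rewrite bE !muln_gt0 J0.
have B0 : 0 < B by rewrite BE expn_gt0 b0.
have X0 : 0 < X by rewrite XE muln_gt0 J0.
have XJK0 : 0 < X * J * K by rewrite !muln_gt0 X0 J0.
have a0 : 0 < a by rewrite aE !muln_gt0 X0 K0.
(* With [n] about [X * J * K * y], the classes have [J * K * y] symbols, so that
   [B] is the number of rounded occurrence profiles and there are [X] classes
   before discarding; [y] is the only parameter that grows with [n]. *)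
exists (10 * a ^ 2 * (X * J * K)) => T A S hA hS.
rewrite leqNgt; apply/negP => lt.
have [n nE] : {n | n = #|A|} by eexists.
rewrite -nE in hA lt.
have [y yE] : {y | y = n %/ (X * J * K)} by eexists.
have ay : 10 * a ^ 2 <= y by rewrite yE leq_divRL.
have y0 : 0 < y by apply: leq_trans ay; rewrite !muln_gt0 a0.
have ny : n < X * J * K * y.+1 by rewrite yE mulnC ltn_ceil.
have yn : X * J * K * y <= n by rewrite yE mulnC leq_trunc_div.
have Sn : size S <= n ^ 2.
  rewrite -(leq_pmul2l K0); apply: leq_trans (ltnW lt); exact: leq_addr.
pose L := (size S %/ (J * a ^ 2)).+1.
have Ja0 : 0 < J * a ^ 2 by rewrite !muln_gt0 J0 a0.
have SL : size S < J * a ^ 2 * L by rewrite mulnC ltn_ceil.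
have LS : J * (a ^ 2 * L) <= size S + J * a ^ 2.
  by rewrite mulnA mulnC mulSn addnC leq_add2r leq_trunc_div.
clearbody L.
(* The [J] windows use [J * (K - 1) * y] symbols of a class and leave [J * y]. Of the room for
   [J * B] classes, [B] are given up to the profiles and [2 * B] to the discarded symbols. *)
have [| | | | | | | | | |l [ul lA /negP]] := @missed_enumeration rat T A S J L a b (B * K * y)
  (n %/ J) (J * K * y) ((J - 3) * B) ((K - 1) * y) (J * y); last by apply; apply: hS.
- exact: ltnW.
- by rewrite !muln_gt0 B0 y0 K0.
- exact: b0.
- by rewrite !muln_gt0 J0 y0 K0.
- by rewrite muln_gt0 subn_gt0 J3 B0.
- by rewrite muln_gt0 J0 y0.
- have n1 : n < (n %/ J).+1 * J by rewrite ltn_ceil.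
  have -> : (n %/ J).+1 * (b * (B * K * y)) = (n %/ J).+1 * J * (X * J * K * (2 * y)).
    by rewrite bE XE; ring.
  apply: leq_ltn_trans Sn _; rewrite -mulnn; apply: ltn_mul => //.
  by apply: leq_trans ny _; rewrite leq_mul2l mul2n -addnn -addn1 leq_add2l y0 orbT.
- rewrite -nE -BE.
  have n2 : n %/ J <= 2 * B * (J * K * y).
    rewrite -(leq_pmul2r J0); apply: leq_trans (leq_trunc_div _ _) _.
    apply: leq_trans (ltnW ny) _.
    have -> : 2 * B * (J * K * y) * J = X * J * K * (2 * y) by rewrite XE; ring.
    by rewrite leq_mul2l mul2n -addnn -addn1 leq_add2l y0 orbT.
  apply: leq_trans yn; have -> : X * J * K * y = J * B * (J * K * y) by rewrite XE; ring.
  apply: leq_trans (leq_add (leqnn _) n2) _; rewrite -mulnDl leq_mul2r; apply/orP; right.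
  by rewrite -addnA -mulSn -mulnDl subnK // ltnW.
- by rewrite -mulnDr -mulSn subn1 prednK // mulnA.
move=> u /andP[hu _].
have EJ : (J%:R = 40 * K%:R ^+ 2 :> rat)%R by rewrite JE -natrX -natrM.
have EX : (X%:R = J%:R * B%:R :> rat)%R by rewrite XE natrM.
have Ea : (a%:R = 40 * X%:R ^+ 2 * K%:R ^+ 2 :> rat)%R by rewrite aE -!natrX -!natrM.
have EQ : (((K - 1) * y)%:R = (K%:R - 1) * y%:R :> rat)%R by rewrite natrM natrB // ltnW.
have h10 : (10 * a%:R ^+ 2 <= y%:R :> rat)%R by rewrite -natrX -natrM ler_nat.
have hn : (n%:R <= X%:R * J%:R * K%:R * (y%:R + 1) :> rat)%R.
  by rewrite natr1 -!natrM ler_nat ltnW.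
have hL : (J%:R * (a%:R ^+ 2 * L%:R) <= (size S)%:R + J%:R * a%:R ^+ 2 :> rat)%R.
  by rewrite -natrX -!natrM -natrD ler_nat.
have K2 : (2 <= K%:R :> rat)%R by rewrite (ler_nat _ 2).
have X1 : (1 <= X%:R :> rat)%R by rewrite (ler_nat _ 1).
have B1 : (1 <= B%:R :> rat)%R by rewrite (ler_nat _ 1).
have Jy : (J%:R <= y%:R :> rat)%R.
  rewrite ler_nat; apply: leq_trans ay.
  have Ja : J <= a by rewrite JE aE mulnAC; apply: leq_pmulr; rewrite !muln_gt0 X0.
  by rewrite -mulnn mulnA; apply: leq_trans Ja _; apply: leq_pmull; rewrite muln_gt0 a0.
rewrite EQ -nE; apply: (window_budget K2 EJ X1 Ea h10 (ler0n _ _) hn _ hL).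
- by rewrite -natrX ler_nat.
- have -> : (((a ^ 2 * L)%:R + (n * (B * K * y))%:R) / ((J * K * y)%:R * ((J - 3) * B)%:R ^+ 2)
    = (a%:R ^+ 2 * L%:R + n%:R * (B%:R * K%:R * y%:R)) /
      (J%:R * K%:R * y%:R * ((J%:R - 3) * B%:R) ^+ 2) :> rat)%R.
    by rewrite !natrM (natrB _ (ltnW J3)).
  apply: (density_bound K2 EJ B1 (ler0n _ _) _ Jy _ _ hL).
  + by apply: le_trans h10; apply: ler_peMl; rewrite ?sqr_ge0 // (ler_nat _ 1).
  + by move: hn; rewrite EX; congr (_ <= _)%R; ring.
  + by rewrite -!natrX -!natrM -natrD ler_nat ltnW.
- by rewrite -EQ -natrM -natrD ler_nat.
Qed.

(** * Relaxation sequences *)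

Lemma sqr_sum_leq (C : finType) (x : C -> nat) :
  (\sum_c x c) ^ 2 <= #|C| * \sum_c x c ^ 2.
Proof.
rewrite -(leq_pmul2l (isT : 0 < 2)).
have -> : 2 * (\sum_c x c) ^ 2 = \sum_c \sum_d 2 * (x c * x d).
  rewrite -mulnn big_distrl big_distrr; apply: eq_bigr => c _.
  by rewrite big_distrr big_distrr.
apply: leq_trans (_ : \sum_c \sum_d (x c ^ 2 + x d ^ 2) <= _).
  by apply: leq_sum => c _; apply: leq_sum => d _; apply: nat_Cauchy.
under eq_bigr do rewrite big_split /= sum_nat_const.
by rewrite big_split /= sum_nat_const -big_distrr /= addnn mul2n.
Qed.

(** * Matchings and the Hamiltonian paths through them *)

Definition endpoints (V : Type) (l : seq (V * V)) : seq V :=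
  flatten [seq [:: e.1; e.2] | e <- l].

(** A connecting edge leads from each edge of [l] to the next, so [l] occupies every second position
    of the path. *)
Lemma subseq_path_edges_endpoints (V : eqType) (l : seq (V * V)) (x : V) (r : seq V) :
  subseq l (path_edges (x :: endpoints l ++ r)).
Proof.
elim: l x => [|[u v] l IH] x; first exact: sub0seq.
apply: subseq_trans (subseq_cons _ (x, u)).
by rewrite /= eqxx; apply: IH.
Qed.

Definition matching_avoiding (V : finType) (s : V) (A : {set V * V}) : Prop :=
  (forall e, e \in A -> [/\ e.1 != s, e.2 != s & e.1 != e.2]) /\
  (forall e f x, e \in A -> f \in A ->
     x \in [:: e.1; e.2] -> x \in [:: f.1; f.2] -> e = f).

Lemma mem_endpoints (V : eqType) (l : seq (V * V)) x :
  x \in endpoints l -> exists2 e, e \in l & x \in [:: e.1; e.2].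
Proof. by move=> /flattenP[w /mapP[e el ->] xw]; exists e. Qed.

Lemma uniq_endpoints (V : finType) (s : V) (A : {set V * V}) l :
  matching_avoiding s A -> uniq l -> {subset l <= A} -> uniq (s :: endpoints l).
Proof.
move=> [mA mA']; rewrite cons_uniq => ul lA; apply/andP; split.
  apply/negP => /mem_endpoints[e /lA/mA[h1 h2 _]].
  by rewrite !inE ![s == _]eq_sym (negbTE h1) (negbTE h2).
elim: l ul lA => [//|e l IH] /= /andP[el ul] lA.
have eA : e \in A by apply: lA; rewrite mem_head.
have lA' : {subset l <= A} by move=> f fl; apply: lA; rewrite inE fl orbT.
have notin x : x \in [:: e.1; e.2] -> x \notin endpoints l.
  move=> xe; apply/negP => /mem_endpoints[f fl xf].
  by move: el; rewrite (mA' e f x eA (lA' f fl) xe xf) fl.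
have [_ _ h] := mA e eA.
by rewrite inE negb_or h !notin ?inE ?eqxx ?orbT // IH.
Qed.

Lemma uniq_path_complete (V : finType) (x : V) (p : seq V) :
  uniq (x :: p) -> path (complete_digraph V) x p.
Proof.
elim: p x => [//|y p IH] x; rewrite cons_uniq => /andP[xp up] /=.
by rewrite IH // andbT /complete_digraph /=; apply: contraNneq xp => ->; rewrite mem_head.
Qed.

(** The distinct endpoints of [l], followed by all remaining vertices, form a Hamiltonian path from
    [s]. *)
Lemma valid_contains_matching (V : finType) (s : V) (S l : seq (V * V)) (A : {set V * V}) :
  valid_relaxation_sequence (complete_digraph V) s S -> matching_avoiding s A ->
  uniq l -> {subset l <= A} -> subseq l [seq e <- S | e \in A].
Proof.
move=> [_ vS] mA ul lA.
have us := uniq_endpoints mA ul lA.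
pose r := [seq x <- enum V | x \notin s :: endpoints l].
have ur : uniq (s :: endpoints l ++ r).
  rewrite -cat_cons cat_uniq us filter_uniq ?enum_uniq // andbT.
  by apply/hasPn => x; rewrite mem_filter => /andP[].
rewrite subseq_filter; apply/andP; split; first by apply/allP.
apply: subseq_trans (subseq_path_edges_endpoints l s r) (vS _ _ _).
  by rewrite /simple_dipath uniq_path_complete.
move=> x; rewrite mem_cat mem_filter mem_enum inE negb_or andbT [RHS]inE.
have [-> | xs] := eqVneq x s; first by move: us => /= /andP[/negbTE -> _].
by case: (x \in endpoints l).
Qed.

(* As [c] varies, these sets partition the ordered pairs of distinct vertices
   other than [s], as in the scheduling of a round-robin tournament. *)
Definition round_robin (V : finType) (s : V) (c : 'I_#|V| * bool) : {set V * V} :=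
  [set e | [&& e.1 != s, e.2 != s, e.1 != e.2,
    (enum_rank e.1 + enum_rank e.2) %% #|V| == c.1 &
    (enum_rank e.1 < enum_rank e.2) == c.2]].

(** The sum of ranks modulo [#|V|] determines either endpoint from the other, and the order bit
    excludes the reversed edge. *)
Lemma round_robin_matching (V : finType) (s : V) c :
  matching_avoiding s (round_robin s c).
Proof.
split=> [e|e f x]; first by rewrite inE => /and5P[].
have cancel (u v w : V) : (enum_rank u + enum_rank v) %% #|V| =
    (enum_rank u + enum_rank w) %% #|V| -> v = w.
  move=> /eqP; rewrite eqn_modDl !modn_small ?ltn_ord // => /eqP h.
  by apply/enum_rank_inj/val_inj.
case: e f => [u v] [u' v']; rewrite !inE /= => /and5P[_ _ _ /eqP h1 /eqP o1].
move=> /and5P[_ _ uv' /eqP h2 /eqP o2].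
have nr : enum_rank u' != enum_rank v' :> nat by apply: contra uv' => /eqP/val_inj/enum_rank_inj ->.
move: h1; rewrite -h2; move: o1; rewrite -o2 => o h.
case/orP => /eqP ->; case/orP => /eqP e; move: o h; rewrite e.
- by move=> _ /cancel ->.
- by move=> + h; rewrite [v](cancel v' v u') ?h 1?addnC //; move: nr; case: ltngtP.
- by move=> + h; rewrite [u](cancel u' u v') -?h 1?addnC //; move: nr; case: ltngtP.
- by move=> _ h; rewrite [u](cancel v' u u') // addnC h addnC.
Qed.

Lemma round_robin_disjoint (V : finType) (s : V) c c' :
  c != c' -> [disjoint round_robin s c & round_robin s c'].
Proof.
move=> cc'; apply/pred0P => e /=; apply/negP; rewrite !inE.
move=> /andP[/and5P[_ _ _ /eqP h1 /eqP h2] /and5P[_ _ _ /eqP h1' /eqP h2']].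
move: cc'; rewrite [c]surjective_pairing [c']surjective_pairing -h2 -h2'.
have -> : c.1 = c'.1 by apply/val_inj; rewrite /= -h1 -h1'.
by rewrite eqxx.
Qed.

(** The diagonal pairs complete the off-diagonal ones to a square, which avoids subtraction. *)
Lemma sum_card_round_robin (V : finType) (s : V) :
  #|V|.-1 ^ 2 <= \sum_c #|round_robin s c| + #|V|.-1.
Proof.
pose W := [set~ s]; have cW : #|W| = #|V|.-1 by rewrite cardsC1.
pose E := [set e : V * V | [&& e.1 != s, e.2 != s & e.1 != e.2]].
have V0 : 0 < #|V| by apply/card_gt0P; exists s.
have -> : \sum_c #|round_robin s c| = #|E|.
  pose col (e : V * V) : 'I_#|V| * bool :=
    (Ordinal (ltn_pmod (enum_rank e.1 + enum_rank e.2) V0), enum_rank e.1 < enum_rank e.2).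
  rewrite -[RHS]sum1_card (partition_big col xpredT) //=; apply: eq_bigr => c _.
  rewrite sum1_card; apply: eq_card => -[u v]; case: c => k o.
  by rewrite [RHS]unfold_in !inE -!andbA.
have -> : #|V|.-1 ^ 2 = #|setX W W| by rewrite cardsX cW mulnn.
have -> : #|V|.-1 = #|[set (u, u) | u in W]| by rewrite card_imset // => u v [].
apply: leq_trans (leq_card_setU _ _); apply: subset_leq_card; apply/subsetP => -[u v].
rewrite !inE /= => /andP[us vs]; rewrite us vs /=; have [->|//] := eqVneq u v.
by apply/orP; right; apply: imset_f; rewrite !inE.
Qed.

(** Integer form of the bound with error [4 / K]. The disjoint matchings share the length of [S],
    and by Cauchy-Schwarz their squared sizes sum to about [n ^ 4 / (2 * n)] at least. *)
Theorem relaxation_lower_bound (K : nat) : 1 < K ->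
  exists N, forall (V : finType) (s : V) (S : seq (V * V)), N <= #|V| ->
    valid_relaxation_sequence (complete_digraph V) s S ->
    K * #|V| ^ 3 <= 2 * K * size S + 8 * #|V| ^ 3.
Proof.
move=> K1; have [N0 HN] := enumerations_lower_bound K1.
(* The three summands absorb the lower-order terms and the matchings smaller than [N0]. *)
exists (3 + 2 * K + 4 * K * N0 ^ 2) => V s S nN vS.
pose A := @round_robin V s; pose n := #|V|.
(* The last term makes the bound trivial for matchings smaller than [N0]. *)
have each c : K * #|A c| ^ 2 <= K * count (mem (A c)) S + 2 * #|A c| ^ 2 + K * N0 ^ 2.
  have [hN|hN] := leqP N0 #|A c|.
    apply: leq_trans (leq_addr _ _); rewrite -size_filter; apply: HN => // l ul lA.
    exact: valid_contains_matching vS (round_robin_matching s c) ul lA.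
  apply: leq_trans (leq_addl _ _); rewrite leq_mul2l; apply/orP; right.
  by rewrite leq_exp2r // ltnW.
have total : K * \sum_c #|A c| ^ 2 <= K * \sum_c count (mem (A c)) S
    + 2 * \sum_c #|A c| ^ 2 + n * 2 * (K * N0 ^ 2).
  have -> : n * 2 * (K * N0 ^ 2) = \sum_(c : 'I_n * bool) K * N0 ^ 2.
    by rewrite sum_nat_const card_prod card_ord card_bool.
  by rewrite !big_distrr /= -!big_split /=; apply: leq_sum.
move: total.
have := sum_count_disjoint S (@round_robin_disjoint V s); rewrite -/A.
have := sqr_sum_leq (fun c => #|A c|); rewrite card_prod card_ord card_bool -/n.
have := sum_card_round_robin s; rewrite -/A -/n.
move: (\sum_c #|A c|) (\sum_c #|A c| ^ 2) (\sum_c count _ S) => T X c hT hX hc hK.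
have n3 : 3 <= n by apply: leq_trans nN; rewrite -addnA leq_addr.
have nK : 2 * K <= n by apply: leq_trans nN; rewrite addnAC leq_addl.
have nN0 : 4 * K * N0 ^ 2 <= n by apply: leq_trans nN; rewrite leq_addl.
rewrite -/n; move: (size S) hc hK => z hc hK; clear -K1 hT hX hc hK n3 nK nN0.
have hT' : n ^ 2 <= T + 3 * n by nia.
have hK' : K * X <= K * z + 2 * X + n * 2 * (K * N0 ^ 2).
  by apply: leq_trans hK _; rewrite !leq_add2r leq_mul2l hc orbT.
move: hT' hX hK' nN0 nK n3 K1.
rewrite -!(ler_nat rat) !(natrM, natrD, natrX).
move: (T%:R : rat)%R (X%:R : rat)%R (z%:R : rat)%R (K%:R : rat)%R (N0%:R : rat)%R (n%:R : rat)%R.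
move=> {hT hc hK}; move=> {}T {}X {}z {}K {}N0 {}n hT1 hX1 hK1 nN0 nK n3 K2.
have n0 : (0 < n)%R by lra.
have sq : (n ^+ 4 - 6 * n ^+ 3 <= T ^+ 2)%R.
  have h : (0 <= n ^+ 2 - 3 * n)%R by nra.
  have : ((n ^+ 2 - 3 * n) ^+ 2 <= T ^+ 2)%R by rewrite ler_sqr ?nnegrE //; lra.
  have := sqr_ge0 n; lra.
have KX : ((K - 2) * T ^+ 2 <= n * 2 * (K * z + n * 2 * (K * N0 ^+ 2)))%R.
  apply: le_trans (_ : ((K - 2) * (n * 2 * X) <= _)%R); first by rewrite ler_wpM2l //; lra.
  have -> : ((K - 2) * (n * 2 * X) = n * 2 * ((K - 2) * X))%R by ring.
  rewrite ler_pM2l ?mulr_gt0 //; lra.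
have Kn : (n * ((K - 2) * (n ^+ 3 - 6 * n ^+ 2)) <= n * (2 * (K * z + n * 2 * (K * N0 ^+ 2))))%R.
  have h : ((K - 2) * (n ^+ 4 - 6 * n ^+ 3) <= (K - 2) * T ^+ 2)%R by rewrite ler_wpM2l //; lra.
  lra.
rewrite ler_pM2l // in Kn.
have h1 : (n ^+ 2 * (2 * K) <= n ^+ 2 * n)%R by rewrite ler_wpM2l ?sqr_ge0.
have h2 : (n * (4 * K * N0 ^+ 2) <= n * n)%R by rewrite ler_wpM2l // ltW.
have h3 : (n ^+ 2 * 1 <= n ^+ 2 * n)%R by rewrite ler_wpM2l ?sqr_ge0 //; lra.
have h4 : (0 <= n ^+ 2)%R := sqr_ge0 n.
clear -Kn h1 h2 h3 h4; lra.
Qed.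

(* Imported only here: [classical_sets] shadows names of [finset]. *)
From mathcomp Require Import boolp classical_sets reals topology normedtype sequences.
Import Order.TTheory GRing.Theory Num.Theory.
Import numFieldNormedType.Exports.
Local Open Scope classical_set_scope.
Local Open Scope ring_scope.

(** * Passage to the limit *)

Theorem theorem1 (R : realType) :
  exists o1 : nat -> R,
    (o1 n @[n --> \oo] --> (0 : R)) /\
    forall (n : nat) (V : finType) (s : V) (S : seq (V * V)),
      (2 <= n)%N -> #|V| = n ->
      valid_relaxation_sequence (complete_digraph V) s S ->
      (2^-1 - o1 n) * n%:R ^+ 3 <= (size S)%:R.
Proof.
(* [P k n] is the bound with error [4 / k.+1]; it is trivial for [k = 0], and
   [o1] uses the best [k <= n] available. *)
pose P k n := forall (V : finType) (s : V) (S : seq (V * V)), #|V| = n ->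
  valid_relaxation_sequence (complete_digraph V) s S ->
  (k.+1 * n ^ 3 <= 2 * k.+1 * size S + 8 * n ^ 3)%N.
have P0 n : `[< P 0%N n >].
  by apply/asboolP => V s S _ _; rewrite mul1n (leq_trans _ (leq_addl _ _)) // leq_pmull.
pose k n : 'I_n.+1 := [arg max_(i > ord0 | `[< P i n >]) (i : nat)]%N.
have kP n : P (k n) n /\ forall i, (i <= n)%N -> P i n -> (i <= k n)%N.
  rewrite /k; case: arg_maxnP => [|i /asboolP Pi imax]; first exact: P0.
  by split=> // j jn Pj; apply: (imax (Ordinal (jn : (j < n.+1)%N))); apply/asboolP.
exists (fun n => 4 / (k n).+1%:R); split.
  apply/cvgr0Pnorm_lt => e e0.
  (* This gives [4 / m < e]; once [P m n] holds with [m <= n], the best index [k n] is at least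
     [m]. *)
  pose m := (Num.truncn (4 / e)).+1.
  have [N HN] := @relaxation_lower_bound m.+1 isT.
  exists (maxn m N) => // n /=; rewrite geq_max => /andP[mn Nn].
  have mk : (m <= k n)%N.
    by apply: (kP n).2 => // V s S Vn; rewrite -Vn; apply: HN; rewrite Vn.
  rewrite ger0_norm ?divr_ge0 // ltr_pdivrMr // mulrC -ltr_pdivrMr //.
  apply: lt_le_trans (truncnS_gt _) _; rewrite ler_nat; exact: leqW.
move=> n V s S _ Vn vS; have := (kP n).1 V s S Vn vS; move: (k n : nat) => j.
rewrite -natrX -(ler_nat R) natrD; move: (n ^ 3)%N => x; rewrite !natrM.
set K := j.+1%:R => h.
have K0 : 0 < K by rewrite ltr0n. clearbody K.
rewrite -(ler_pM2l K0).
have -> : K * ((2^-1 - 4 / K) * x%:R) = (K * x%:R - 8 * x%:R) / 2 by field; exact: lt0r_neq0.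
lra.
Qed.
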